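(* There is an absolute constant $C>0$ such that the following holds. Let $m\ge 2$, let $A\in\mathbb{R}^{m\times n}$ have rank $m$, let $b\in\mathbb{R}^m$, and let $P=\{x\in\mathbb{R}^n : Ax=b,\ x\ge \mathbf{0}\}$. Then the circuit diameter of $P$ is at most $C\,m^2\log m$; that is, for every pair of vertices $u,v$ of $P$ there is a circuit walk in $P$ from $u$ to $v$ of length at most $C\,m^2\log m$.
   Context: For a vector $z\in\mathbb{R}^n$, $\operatorname{supp}(z)=\{i: z_i\ne 0\}$. An elementary vector of $A$ is a nonzero vector $g\in\ker(A)$ of inclusion-minimal support, i.e. there is no $h\in\ker(A)\setminus\{\mathbf 0\}$ with $\operatorname{supp}(h)\subsetneq\operatorname{supp}(g)$. A circuit walk in $P$ of length $k$ from $x$ to $y$ is a sequence $x=x^{(0)},x^{(1)},\ldots,x^{(k)}=y$ of points of $P$ such that for each $i\in\{0,\dots,k-1\}$ one has $x^{(i+1)}=x^{(i)}+\alpha^{(i)}g^{(i)}$ for some elementary vector $g^{(i)}$ of $A$ and some real $\alpha^{(i)}>0$ that is chosen maximally, i.e. $x^{(i)}+\alpha' g^{(i)}\notin P$ for every $\alpha'>\alpha^{(i)}$. The circuit diameter of $P$ is the maximum, over all ordered pairs of vertices $u,v$ of $P$, of the length of a shortest circuit walk from $u$ to $v$. *)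

(* Defs.v *)
From HB Require Import structures.
From mathcomp Require Import all_boot all_order all_algebra.
From mathcomp Require Import all_classical all_reals all_analysis.

Set Implicit Arguments.
Unset Strict Implicit.
Unset Printing Implicit Defensive.

Import Order.TTheory GRing.Theory Num.Theory.

Local Open Scope classical_set_scope.
Local Open Scope ring_scope.

Definition supp (R : realType) (n : nat) (z : 'cV[R]_n) : {set 'I_n} :=
  [set i | z i 0 != 0]%SET.

Definition elementary_vector (R : realType) (m n : nat) (A : 'M[R]_(m, n))
    (g : 'cV[R]_n) : Prop :=
  [/\ g != 0, A *m g = 0 &
      ~ exists h : 'cV[R]_n, [/\ A *m h = 0, h != 0 & supp h \proper supp g]].

Definition polyhedron (R : realType) (m n : nat) (A : 'M[R]_(m, n))
    (b : 'cV[R]_m) : set 'cV[R]_n :=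
  [set x | A *m x = b /\ forall i, 0 <= x i 0].

(* A vertex is an extreme point. *)
Definition vertex (R : realType) (n : nat) (P : set 'cV[R]_n)
    (x : 'cV[R]_n) : Prop :=
  P x /\ forall (y z : 'cV[R]_n) (t : R), P y -> P z -> 0 < t < 1 ->
    x = t *: y + (1 - t) *: z -> y = x /\ z = x.

Definition circuit_step (R : realType) (m n : nat) (A : 'M[R]_(m, n))
    (P : set 'cV[R]_n) (x y : 'cV[R]_n) : Prop :=
  exists (g : 'cV[R]_n) (a : R),
    [/\ elementary_vector A g, 0 < a, y = x + a *: g &
        forall a' : R, a < a' -> ~ P (x + a' *: g)].

(* Only the values w 0, ..., w k of the sequence w are meaningful. *)
Definition circuit_walk (R : realType) (m n : nat) (A : 'M[R]_(m, n))
    (P : set 'cV[R]_n) (k : nat) (x y : 'cV[R]_n) : Prop :=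
  exists w : nat -> 'cV[R]_n,
    [/\ w 0%N = x, w k = y,
        forall i, (i <= k)%N -> P (w i) &
        forall i, (i < k)%N -> circuit_step A P (w i) (w i.+1)].

(* +oo when there is no circuit walk from x to y. *)
Definition circuit_distance (R : realType) (m n : nat) (A : 'M[R]_(m, n))
    (P : set 'cV[R]_n) (x y : 'cV[R]_n) : \bar R :=
  ereal_inf [set (k%:R)%:E | k in [set k : nat | circuit_walk A P k x y]].

(* A polyhedron has finitely many vertices, so that this supremum is a maximum;
   it is -oo if P is empty. *)
Definition circuit_diameter (R : realType) (m n : nat) (A : 'M[R]_(m, n))
    (P : set 'cV[R]_n) : \bar R :=
  ereal_sup [set circuit_distance A P uv.1 uv.2 |
             uv in [set uv | vertex P uv.1 /\ vertex P uv.2]].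

(* Main.v *)
(** Call a coordinate i of x far when x_i > (4m+1) v_i, where v is the target
    vertex. Every step below is chosen so that no coordinate becomes far and far
    coordinates do not increase; once none is far, supp x is contained in supp v
    and x = v. At most m coordinates are far at the start, so it suffices to make
    one more coordinate non-far within O(m log m) steps.

    Let p be the current point and T its set of far coordinates. Steps conformal
    to v - x make sum_(i in T) x_i / p_i shrink by a factor 1 - 1/(4m), so after
    O(m log m) of them x_i <= p_i / (16 m^3) on T, if T has not changed. Reflecting
    p through v then pays off: the direction (4m+1)(v - x) + (v - p) decreases the
    coordinates of T by far more than x_T, while on the other coordinates its
    negative part is at most (4m+1) x because p_i <= (4m+1) v_i there. Hence some
    conformal circuit is blocked by a coordinate of T, which becomes zero. *)

Require Import Defs.
From HB Require Import structures.
From mathcomp Require Import all_boot all_order all_algebra.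
From mathcomp Require Import all_classical all_reals all_analysis.
From mathcomp Require Import ring lra.

Import Order.TTheory GRing.Theory Num.Theory.

Local Open Scope classical_set_scope.
Local Open Scope ring_scope.

(** * Supports and conformal elementary vectors *)

Lemma suppP (R : realType) (n : nat) (z : 'cV[R]_n) i :
  (i \in supp z) = (z i 0 != 0).
Proof. by rewrite inE. Qed.

(** The multiple [t] is the smallest ratio [q i 0 / h i 0] over the coordinates where [h] and [q]
    agree in sign: the first of these to vanish does so before any coordinate changes sign. *)
Lemma conformal_sub (R : realType) (n : nat) (q h : 'cV[R]_n) (k : 'I_n) :
  supp h \subset supp q -> 0 < h k 0 * q k 0 ->
  exists2 t : R, 0 < t &
    supp (q - t *: h) \proper supp q /\
    forall i, (q - t *: h) i 0 != 0 -> 0 < (q - t *: h) i 0 * q i 0.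
Proof.
move=> /fintype.subsetP hq hk.
case: (@Order.TotalTheory.arg_minP _ _ _ k (fun i => 0 < h i 0 * q i 0)
         (fun i => q i 0 / h i 0) hk) => j hj jmin.
have hj0 : h j 0 != 0 by apply: contraTN hj => /eqP ->; rewrite mul0r ltxx.
have qj0 : q j 0 != 0 by apply: contraTN hj => /eqP ->; rewrite mulr0 ltxx.
have t0 : 0 < q j 0 / h j 0.
  have -> : q j 0 / h j 0 = h j 0 * q j 0 / (h j 0) ^+ 2 by field.
  by rewrite divr_gt0// exprn_even_gt0.
exists (q j 0 / h j 0) => //; split.
  apply/properP; split.
    apply/fintype.subsetP => i; rewrite !suppP !mxE; apply: contraNN => /eqP qi0.
    have : i \notin supp h by apply/negP => /hq; rewrite suppP qi0 eqxx.
    by rewrite suppP negbK qi0 => /eqP ->; rewrite mulr0 subrr.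
  exists j; first by rewrite suppP.
  by rewrite suppP negbK !mxE divfK// subrr.
move=> i; rewrite !mxE; set t := q j 0 / h j 0 => nz.
have [hi|hi] := ltP 0 (h i 0 * q i 0); last first.
  have [qi0|qi0] := eqVneq (q i 0) 0.
    have : i \notin supp h by apply/negP => /hq; rewrite suppP qi0 eqxx.
    by rewrite suppP negbK => /eqP hi0; move: nz; rewrite qi0 hi0 mulr0 subrr eqxx.
  have : 0 < q i 0 ^+ 2 by rewrite exprn_even_gt0.
  have : t * (h i 0 * q i 0) <= 0 by rewrite pmulr_rle0.
  rewrite expr2; nra.
have ti := jmin i hi.
have hi0 : h i 0 != 0 by apply: contraTN hi => /eqP ->; rewrite mul0r ltxx.
have : 0 <= (q i 0 - t * h i 0) * q i 0.
  have -> : (q i 0 - t * h i 0) * q i 0 = (q i 0 / h i 0 - t) * (h i 0 * q i 0).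
    by field.
  by rewrite mulr_ge0 ?subr_ge0 // ltW.
rewrite le_eqVlt => /orP[|//]; rewrite eq_sym mulf_eq0 (negbTE nz) /= => /eqP qi0.
by move: hi; rewrite qi0 mulr0 ltxx.
Qed.

(* An averaging principle: it replaces the decomposition of q into conformal
   elementary vectors, and needs no count of its terms. *)
Lemma conformal_elementary (R : realType) (m n : nat) (A : 'M[R]_(m, n))
    (l : 'I_n -> R) (q : 'cV[R]_n) :
  A *m q = 0 -> 0 < \sum_i l i * q i 0 ->
  exists g : 'cV[R]_n, [/\ elementary_vector A g,
    forall i, g i 0 != 0 -> 0 < g i 0 * q i 0 & 0 < \sum_i l i * g i 0].
Proof.
pose L (z : 'cV[R]_n) := \sum_i l i * z i 0.
have LB (z h : 'cV[R]_n) (t : R) : L (z - t *: h) = L z - t * L h.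
  rewrite /L mulr_sumr -sumrB; apply: eq_bigr => i _; rewrite !mxE; ring.
have LN h : L (- h) = - L h.
  by rewrite /L -sumrN; apply: eq_bigr => i _; rewrite mxE mulrN.
have suppN (h : 'cV[R]_n) : supp (- h) = supp h.
  by apply/finset.setP => i; rewrite !suppP mxE oppr_eq0.
have [N] := ubnP #|supp q|; elim: N q => // N IH q /ltnSE qN Aq Lq.
have [el|nel] := pselect (elementary_vector A q).
  exists q; split => // i qi; by rewrite -expr2 exprn_even_gt0.
have q0 : q != 0.
  apply: contraTN Lq => /eqP ->.
  by rewrite big1 ?ltxx// => i _; rewrite mxE mulr0.
have : exists h : 'cV[R]_n, [/\ A *m h = 0, h != 0 & supp h \proper supp q].
  by apply: contrapT => nh; apply: nel; split.
have trans (q' : 'cV[R]_n) : A *m q' = 0 -> 0 < L q' -> supp q' \proper supp q ->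
    (forall i, q' i 0 != 0 -> 0 < q' i 0 * q i 0) ->
    exists g : 'cV[R]_n, [/\ elementary_vector A g,
      forall i, g i 0 != 0 -> 0 < g i 0 * q i 0 & 0 < L g].
  move=> Aq' Lq' sq' cq'.
  have [|//|//|g [eg cg Lg]] := IH q'; first exact: leq_trans (proper_card sq') qN.
  exists g; split => // i gi.
  have c1 := cg i gi.
  have q'i : q' i 0 != 0 by apply: contraTN c1 => /eqP ->; rewrite mulr0 ltxx.
  have c2 := cq' i q'i.
  have : 0 < q' i 0 ^+ 2 by rewrite exprn_even_gt0.
  move: (mulr_gt0 c1 c2).
  have -> : g i 0 * q' i 0 * (q' i 0 * q i 0) = q' i 0 ^+ 2 * (g i 0 * q i 0) by ring.
  by move=> + s; rewrite pmulr_rgt0.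
(* Since [L h <= 0], removing a positive multiple of [h] keeps [L] positive, and the induction
   applies to the smaller vector. *)
have sub (h : 'cV[R]_n) k : A *m h = 0 -> supp h \subset supp q -> L h <= 0 ->
    0 < h k 0 * q k 0 ->
    exists g : 'cV[R]_n, [/\ elementary_vector A g,
      forall i, g i 0 != 0 -> 0 < g i 0 * q i 0 & 0 < L g].
  move=> Ah sh Lh hk; have [t t0 [s c]] := conformal_sub _ _ _ _ _ sh hk.
  apply: (trans (q - t *: h)) => //.
    by rewrite mulmxBr -scalemxAr Ah scaler0 subr0.
  rewrite LB subr_gt0; apply: le_lt_trans Lq; rewrite pmulr_rle0//.
move=> [h0 [Ah0 h00 sh0]].
have [h [Ah hn0 sh Lh]] : exists h : 'cV[R]_n,
    [/\ A *m h = 0, h != 0, supp h \proper supp q & L h <= 0].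
  have [Lh|Lh] := leP (L h0) 0; first by exists h0.
  exists (- h0); split; rewrite ?mulmxN ?Ah0 ?oppr0 ?oppr_eq0 ?suppN//.
  by rewrite LN oppr_le0 ltW.
have [[k hk]|nk] := pselect (exists k, 0 < h k 0 * q k 0).
  exact: (sub h k Ah (proper_sub sh)).
(* Now [h] agrees in sign with [q] nowhere, so [- h] is conformal to [q]. If [L h < 0], it serves as
   the smaller vector; if [L h = 0], subtracting a multiple of it from [q] leaves [L] unchanged. *)
have cNh i : (- h) i 0 != 0 -> 0 < (- h) i 0 * q i 0.
  rewrite mxE oppr_eq0 => hi.
  have qi : q i 0 != 0 by have /fintype.subsetP := proper_sub sh; move=> /(_ i); rewrite !suppP; apply.
  have : h i 0 * q i 0 != 0 by rewrite mulf_neq0.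
  rewrite mulNr oppr_gt0 lt_neqAle => ->/=.
  by rewrite leNgt; apply/negP => p; apply: nk; exists i.
have [Lh0|Lh0] := eqVneq (L h) 0.
  have [i hi] : exists i, (- h) i 0 != 0.
    apply: contrapT => ni; move/eqP: hn0; apply; apply/colP => i; rewrite mxE.
    apply: contrapT => /eqP hi; apply: ni; exists i; by rewrite mxE oppr_eq0.
  apply: (sub (- h) i); rewrite ?mulmxN ?Ah ?oppr0 ?suppN ?LN ?Lh0 ?oppr0//.
    exact: proper_sub.
  exact: cNh.
apply: (trans (- h)); rewrite ?mulmxN ?Ah ?oppr0 ?suppN ?LN//.
by rewrite oppr_gt0 lt_neqAle Lh0.
Qed.

(** * Maximal steps and vertices *)

(** Ratio test: the coordinate [j] that first reaches zero determines the largest feasible step and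
    is recorded as the blocking one. *)
Lemma maximal_step (R : realType) (m n : nat) (A : 'M[R]_(m, n))
    (b : 'cV[R]_m) (x g : 'cV[R]_n) (k : 'I_n) :
  polyhedron A b x -> elementary_vector A g -> g k 0 < 0 ->
  (forall i, g i 0 < 0 -> 0 < x i 0) ->
  exists (a : R) (j : 'I_n), [/\ 0 < a,
    polyhedron A b (x + a *: g), circuit_step A (polyhedron A b) x (x + a *: g),
    g j 0 < 0 & x j 0 = a * - g j 0].
Proof.
move=> [Ax x0] eg gk xg.
case: (@Order.TotalTheory.arg_minP _ _ _ k (fun i => g i 0 < 0)
         (fun i => x i 0 / - g i 0) gk) => j gj jmin.
set a := x j 0 / - g j 0 in jmin.
have a0 : 0 < a by rewrite divr_gt0 ?oppr_gt0// xg.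
have xj : x j 0 = a * - g j 0 by rewrite divfK// oppr_eq0 lt_eqF.
have Ag : A *m g = 0 by case: eg.
have Px : polyhedron A b (x + a *: g).
  split; first by rewrite mulmxDr -scalemxAr Ag scaler0 addr0.
  move=> i; rewrite !mxE; have [gi|gi] := ltP (g i 0) 0.
    have := jmin i gi; rewrite ler_pdivlMr ?oppr_gt0//; lra.
  by rewrite addr_ge0// mulr_ge0// ltW.
exists a, j; split => //.
exists g, a; split => // a' aa' [_ /(_ j)]; rewrite !mxE; nra.
Qed.

(** Otherwise [u] would be the midpoint of two distinct feasible points. *)
Lemma vertex_ker (R : realType) (m n : nat) (A : 'M[R]_(m, n))
    (b : 'cV[R]_m) (u h : 'cV[R]_n) :
  vertex (polyhedron A b) u -> A *m h = 0 -> supp h \subset supp u -> h = 0.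
Proof.
move=> [[Au u0] ext] Ah /fintype.subsetP hu.
(* s^-1 is a step length for which u +- s^-1 h stays nonnegative; the terms with
   u i 0 = 0 vanish. *)
pose s := 1 + \sum_i `|h i 0| / u i 0.
have sum0 : 0 <= \sum_i `|h i 0| / u i 0 by apply: sumr_ge0 => i _; rewrite divr_ge0.
have s0 : 0 < s by rewrite /s; lra.
have hs i : `|h i 0| <= s * u i 0.
  have [ui|ui] := eqVneq (u i 0) 0.
    have : i \notin supp h by apply/negP => /hu; rewrite suppP ui eqxx.
    by rewrite suppP negbK => /eqP ->; rewrite ui mulr0 normr0.
  have ui0 : 0 < u i 0 by rewrite lt_neqAle eq_sym ui u0.
  rewrite -ler_pdivrMr//.
  rewrite /s (bigD1 i)//=; apply: (@le_trans _ _ (`|h i 0| / u i 0)) => //.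
  rewrite addrCA lerDl addr_ge0// sumr_ge0// => k _; by rewrite divr_ge0.
have hs1 i : `|s^-1 * h i 0| <= u i 0.
  by rewrite normrM gtr0_norm ?invr_gt0// mulrC ler_pdivrMr// mulrC.
have [] // := ext (u + s^-1 *: h) (u - s^-1 *: h) 2^-1.
- split; first by rewrite mulmxDr -scalemxAr Ah scaler0 addr0.
  by move=> i; rewrite !mxE; have := hs1 i; rewrite ler_norml => /andP[]; lra.
- split; first by rewrite mulmxBr -scalemxAr Ah scaler0 subr0.
  by move=> i; rewrite !mxE; have := hs1 i; rewrite ler_norml => /andP[]; lra.
- by lra.
- by apply/colP => i; rewrite !mxE; lra.
move=> /eqP; rewrite -subr_eq0 addrAC subrr add0r scaler_eq0 invr_eq0 gt_eqF//=.
by move=> /eqP.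
Qed.

(** More than [m] columns of [A] are linearly dependent, and a dependency among the columns in
    [supp u] is a kernel vector excluded by [vertex_ker]. *)
Lemma card_supp_vertex (R : realType) (m n : nat) (A : 'M[R]_(m, n))
    (b : 'cV[R]_m) (u : 'cV[R]_n) :
  vertex (polyhedron A b) u -> (#|supp u| <= m)%N.
Proof.
move=> vu; rewrite leqNgt; apply/negP => mu.
pose f (k : 'I_#|supp u|) : 'I_n := enum_val k.
pose E : 'M[R]_(n, #|supp u|) := colsub f 1%:M.
have AE : A *m E = colsub f A by rewrite /E -[in RHS](mulmx1 A) mulmx_colsub.
have : ~~ row_free (colsub f A)^T.
  rewrite /row_free mxrank_tr neq_ltn; apply/orP; left.
  exact: leq_ltn_trans (rank_leq_row _) mu.
rewrite -kermx_eq0 => /rowV0Pn[y /sub_kermxP yA y0].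
have : E *m y^T = 0.
  apply: (vertex_ker _ _ _ _ _ _ _ vu).
    by rewrite mulmxA AE -[LHS]trmxK trmx_mul trmxK yA trmx0.
  apply/fintype.subsetP => i; rewrite suppP; apply: contraNT => ui.
  rewrite mxE big1// => k _; rewrite !mxE.
  have -> : (i == f k) = false.
    by apply/eqP => ik; move: ui; rewrite ik /f enum_valP.
  by rewrite mul0r.
move=> Ey; move/eqP: y0; apply; apply/rowP => k.
move/colP: Ey => /(_ (f k)); rewrite !mxE (bigD1 k)//= !mxE eqxx mul1r => yk.
rewrite -[LHS]addr0 -[RHS]yk; congr (_ + _); apply/esym/big1 => l lk; rewrite !mxE.
by rewrite (inj_eq enum_val_inj) eq_sym (negbTE lk) mul0r.
Qed.

(* The last conclusion is homogeneous in y: d rewards the decrease of chosen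
   coordinates, r penalizes moving the others, and a blocking coordinate j
   (y_j = - x_j) gives a lower bound on the penalty or an upper bound on the
   reward. *)
Lemma conformal_step (R : realType) (m n : nat) (A : 'M[R]_(m, n))
    (b : 'cV[R]_m) (x q : 'cV[R]_n) (d r : 'I_n -> R) :
  polyhedron A b x -> A *m q = 0 -> (forall i, q i 0 < 0 -> 0 < x i 0) ->
  (forall i, 0 <= d i) -> (forall i, 0 <= r i) ->
  \sum_i r i * `|q i 0| < - \sum_i d i * q i 0 ->
  exists y : 'cV[R]_n, [/\ polyhedron A b (x + y),
    circuit_step A (polyhedron A b) x (x + y),
    forall i, y i 0 != 0 -> 0 < y i 0 * q i 0,
    exists2 j, y j 0 < 0 & y j 0 = - x j 0 &
    \sum_i r i * `|y i 0| < - \sum_i d i * y i 0].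
Proof.
move=> Px Aq xq d0 r0 lt_rd.
(* On vectors conformal to [q], multiplying by the sign of [q i 0] gives the absolute value, so the
   linear form [l] computes reward minus penalty there. *)
pose l i := - d i - r i * Num.sg (q i 0).
have lE (z : 'cV[R]_n) : (forall i, Num.sg (q i 0) * z i 0 = `|z i 0|) ->
    \sum_i l i * z i 0 = - \sum_i d i * z i 0 - \sum_i r i * `|z i 0|.
  move=> zq; rewrite -sumrN -sumrB; apply: eq_bigr => i _.
  by rewrite -zq /l; ring.
have [|g [eg cg lg]] := @conformal_elementary R m n A l q Aq.
  by rewrite lE ?subr_gt0// => i; rewrite -normrEsg.
have sg_g i : Num.sg (q i 0) * g i 0 = `|g i 0|.
  have [->|gi] := eqVneq (g i 0) 0; first by rewrite mulr0 normr0.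
  have := cg i gi; have [qi|qi|<-] := ltgtP 0 (q i 0).
  - by rewrite pmulr_lgt0// => ?; rewrite gtr0_sg// mul1r gtr0_norm.
  - by rewrite nmulr_lgt0// => ?; rewrite ltr0_sg// mulN1r ltr0_norm.
  - by rewrite mulr0 ltxx.
move: lg; rewrite lE// subr_gt0 => lg.
have [k gk] : exists k, g k 0 < 0.
  apply: contrapT => ng; move: lg; apply/negP; rewrite -leNgt.
  apply: (@le_trans _ _ 0).
    rewrite oppr_le0 sumr_ge0// => i _; rewrite mulr_ge0// leNgt.
    by apply/negP => gi; apply: ng; exists i.
  by rewrite sumr_ge0// => i _; rewrite mulr_ge0.
have [a [j [a0 Pxg st gj xj]]] := maximal_step _ _ _ _ _ _ _ _ Px eg gk
  (fun i (gi : g i 0 < 0) => xq i ltac:(by rewrite -(nmulr_rgt0 _ gi) cg// lt_eqF)).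
exists (a *: g); split => //.
- move=> i; rewrite mxE mulf_eq0 negb_or => /andP[_ gi].
  by rewrite -mulrA mulr_gt0// cg.
- by exists j; rewrite mxE ?xj; [rewrite pmulr_rlt0|rewrite mulrN opprK].
have -> : \sum_i r i * `|(a *: g) i 0| = a * \sum_i r i * `|g i 0|.
  rewrite mulr_sumr; apply: eq_bigr => i _.
  by rewrite mxE normrM gtr0_norm// mulrCA.
have -> : \sum_i d i * (a *: g) i 0 = a * \sum_i d i * g i 0.
  by rewrite mulr_sumr; apply: eq_bigr => i _; rewrite mxE mulrCA.
by rewrite -mulrN ltr_pM2l.
Qed.

(** * Far coordinates and the two kinds of step *)

(** A coordinate below [v i 0] that rises by less than [4 * k] times [v i 0] stays below this
    threshold. The theorem takes [k] equal to [m]. *)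
Definition far {R : realType} {n : nat} (k : nat) (v x : 'cV[R]_n) : {set 'I_n} :=
  [set i | (4 * k + 1)%:R * v i 0 < x i 0]%SET.

Lemma term_le_sum (R : realType) (n : nat) (P : pred 'I_n) (F : 'I_n -> R) j :
  (forall i, P i -> 0 <= F i) -> P j -> F j <= \sum_(i | P i) F i.
Proof.
move=> F0 Pj; rewrite (bigD1 j)//= lerDl sumr_ge0// => i /andP[Pi _]; exact: F0.
Qed.

(** The reward is [4 * k / c] times the decrease of the weighted sum. The blocking coordinate forces
    it to be at least 1, which gives the factor; it never exceeds [4 * k], so a rising coordinate
    gains less than [4 * k] times its target and does not become far. *)
Lemma reduction_step (R : realType) (m n k : nat) (A : 'M[R]_(m, n))
    (b : 'cV[R]_m) (v x p : 'cV[R]_n) :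
  polyhedron A b v -> polyhedron A b x -> (0 < k)%N ->
  (#|supp v| <= k)%N -> (#|far k v x| <= k)%N -> far k v x != finset.set0 ->
  (forall i, i \in far k v x -> 0 < p i 0) ->
  exists x' : 'cV[R]_n, [/\ polyhedron A b x',
    circuit_step A (polyhedron A b) x x',
    far k v x' \subset far k v x &
    \sum_(i in far k v x) x' i 0 / p i 0 <=
      (1 - (4 * k%:R)^-1) * \sum_(i in far k v x) x i 0 / p i 0].
Proof.
move=> [Av v0] Px k0 cv cT /set0Pn[i0 i0T] p0; have [Ax x0] := Px.
set T := far k v x in cT i0T p0 *; set c := \sum_(i in T) x i 0 / p i 0.
have k1 : 1 <= k%:R :> R by rewrite ler1n.
have Tx i : i \in T -> 0 < x i 0 /\ 5 * v i 0 <= x i 0.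
  rewrite inE natrD natrM => xi; have := v0 i; nra.
have c0 : 0 < c.
  apply: (@lt_le_trans _ _ (x i0 0 / p i0 0)).
    by rewrite divr_gt0 ?p0//; case: (Tx _ i0T).
  apply: (@term_le_sum _ _ (mem T) (fun i => x i 0 / p i 0)) => // i iT.
  by rewrite divr_ge0 ?x0// ltW ?p0.
(* For v - x each term of the penalty is at most 1 and only those in T or supp v
   are nonzero, whereas the reward is at least 4/5 * 4k. *)
pose d i := if i \in T then 4 * k%:R / c / p i 0 else 0.
pose r i := (Num.max (x i 0) (v i 0))^-1.
have dE (z : 'cV[R]_n) : \sum_i d i * z i 0 = 4 * k%:R / c * \sum_(i in T) z i 0 / p i 0.
  rewrite mulr_sumr [RHS]big_mkcond; apply: eq_bigr => i _ /=.
  by rewrite /d; case: ifP => _; rewrite ?mul0r//; ring.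
have r0 i : 0 <= r i by rewrite invr_ge0 le_max x0.
have [|||//||y [Pxy st cy [j yj yjx] ry]] := @conformal_step R m n A b x (v - x) d r Px.
- by rewrite mulmxBr Ax Av subrr.
- by move=> i; rewrite !mxE; have := v0 i; lra.
- by move=> i; rewrite /d; case: ifP => // iT; rewrite !divr_ge0// ?ltW ?p0.
- rewrite dE.
  apply: (@le_lt_trans _ _ (2 * k%:R)).
    apply: (@le_trans _ _ (\sum_(i in T :|: supp v) 1)); last first.
      rewrite sumr_const -[leLHS]/(_%:R) -natrM ler_nat mul2n -addnn.
      by rewrite (leq_trans (leq_card_setU _ _))// leq_add.
    rewrite [leRHS]big_mkcond; apply: ler_sum => i _; rewrite !mxE.
    have max0 : 0 <= Num.max (x i 0) (v i 0) by rewrite le_max x0.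
    case: ifPn => [_|]; last first.
      rewrite finset.in_setU negb_or !inE -leNgt negbK => /andP[+ /eqP vi]; rewrite vi mulr0 => xi.
      have -> : x i 0 = 0 by apply/eqP; rewrite eq_le xi x0.
      by rewrite subrr normr0 mulr0.
    (* When both entries vanish, [r i] is the inverse of zero, which is 0 by convention. *)
    rewrite /r; have [->|mx] := eqVneq (Num.max (x i 0) (v i 0)) 0.
      by rewrite invr0 mul0r.
    rewrite mulrC ler_pdivrMr ?lt_neqAle ?max0 1?eq_sym ?mx// mul1r.
    rewrite le_max; have := v0 i; have := x0 i.
    by case: (ler0P (v i 0 - x i 0)) => ? ? ?; apply/orP; [left|right]; lra.
  have : 4 / 5 * c <= - \sum_(i in T) (v - x) i 0 / p i 0.
    rewrite /c mulr_sumr -sumrN; apply: ler_sum => i iT; rewrite !mxE.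
    rewrite mulrA -mulNr ler_pM2r ?invr_gt0 ?p0//.
    by have [] := Tx i iT; lra.
  rewrite -mulrN => h.
  apply: (@lt_le_trans _ _ (4 * k%:R / c * (4 / 5 * c))).
    have -> : 4 * k%:R / c * (4 / 5 * c) = 16 / 5 * k%:R by field; rewrite gt_eqF.
    lra.
  by rewrite ler_pM2l// divr_gt0//; lra.
rewrite dE in ry; set s := \sum_(i in T) y i 0 / p i 0 in ry.
have [_ xy0] := Pxy.
have ryi i : r i * `|y i 0| < - (4 * k%:R / c * s).
  apply: le_lt_trans ry.
  by apply: (@term_le_sum _ _ xpredT (fun i => r i * `|y i 0|)) => // ? _; rewrite mulr_ge0.
have sc : - s <= c.
  rewrite /s -sumrN; apply: ler_sum => i iT; rewrite -mulNr ler_pM2r ?invr_gt0 ?p0//.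
  by have := xy0 i; rewrite mxE; lra.
have s4 : - (4 * k%:R / c * s) <= 4 * k%:R.
  have -> : - (4 * k%:R / c * s) = 4 * k%:R / c * - s by ring.
  apply: (@le_trans _ _ (4 * k%:R / c * c)); last by rewrite divfK// gt_eqF.
  by rewrite ler_pM2l// divr_gt0//; lra.
have yq i : (y i 0 < 0 -> v i 0 < x i 0) /\ (0 < y i 0 -> x i 0 < v i 0).
  have := cy i; rewrite !mxE => h; split => yi.
    by have := h (negbT (lt_eqF yi)); nra.
  by have := h (negbT (gt_eqF yi)); nra.
exists (x + y); split => //.
  apply/fintype.subsetP => i; apply: contraLR.
  rewrite !inE -!leNgt mxE => xi; have [yi|yi] := leP (y i 0) 0; first by lra.
  have xv := (yq i).2 yi.
  have vi : 0 < v i 0 by exact: le_lt_trans xv.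
  have := lt_le_trans (ryi i) s4.
  rewrite /r (max_r (ltW xv)) gtr0_norm// mulrC ltr_pdivrMr// natrD natrM; lra.
have : 1 <= - (4 * k%:R / c * s).
  apply: ltW; apply: le_lt_trans (ryi j).
  have xj : 0 < x j 0 by lra.
  by rewrite /r (max_l (ltW ((yq j).1 yj))) yjx normrN gtr0_norm// mulVf// gt_eqF.
have -> : - (4 * k%:R / c * s) = - s * (4 * k%:R) / c by ring.
rewrite ler_pdivlMr// mul1r => cs.
have -> : \sum_(i in T) (x + y) i 0 / p i 0 = c + s.
  by rewrite -big_split; apply: eq_bigr => i _; rewrite mxE mulrDl.
have k4 : 0 < 4 * k%:R :> R by lra.
rewrite mulrBl mul1r lerD2l lerNr mulrC ler_pdivrMr//.
Qed.

(** A far coordinate can lose at most its own value, so the total reward is at most [k], while a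
    blocking coordinate that is not far would alone cost a penalty of [k]. Hence the blocking
    coordinate is far, and it becomes zero. *)
Lemma finishing_step (R : realType) (m n k : nat) (A : 'M[R]_(m, n))
    (b : 'cV[R]_m) (v x p : 'cV[R]_n) :
  polyhedron A b v -> polyhedron A b x -> polyhedron A b p -> (0 < k)%N ->
  (#|supp v| <= k)%N -> (#|far k v x| <= k)%N -> far k v x != finset.set0 ->
  far k v p = far k v x ->
  (forall i, i \in far k v x -> 16 * k%:R ^+ 3 * x i 0 <= p i 0) ->
  exists x' : 'cV[R]_n, [/\ polyhedron A b x',
    circuit_step A (polyhedron A b) x x' & far k v x' \proper far k v x].
Proof.
move=> [Av v0] Px [Ap p0] k0 cv cT /set0Pn[i0 i0T] Tp xp; have [Ax x0] := Px.
have pT i : (i \in far k v x) = ((4 * k + 1)%:R * v i 0 < p i 0) by rewrite -Tp inE.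
set T := far k v x in cT i0T pT xp *.
have k1 : 1 <= k%:R :> R by rewrite ler1n.
have kE : (4 * k + 1)%:R = 4 * k%:R + 1 :> R by rewrite natrD natrM.
have nT i : i \notin T -> x i 0 <= (4 * k%:R + 1) * v i 0 /\
    p i 0 <= (4 * k%:R + 1) * v i 0.
  by move=> iT; split; rewrite -kE leNgt; [move: iT; rewrite inE | rewrite -pT].
have Tx i : i \in T -> [/\ 0 < x i 0, (4 * k%:R + 1) * v i 0 < x i 0
    & (4 * k%:R + 1) * v i 0 < p i 0].
  move=> iT; have := iT; rewrite inE kE => xi; move: iT; rewrite pT kE => pi.
  by split => //; have := v0 i; nra.
(* Off T, the term (4k+1) v - p >= 0 keeps the decrease of q proportional to x. *)
pose q := (4 * k%:R + 1) *: (v - x) + (v - p).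
have qE i : q i 0 = (4 * k%:R + 1) * (v i 0 - x i 0) + (v i 0 - p i 0).
  by rewrite !mxE.
(* Here [v i 0 < x i 0], and [v i 0] is at most a fifth of [p i 0], so the reflection term alone
   makes [- q i 0] at least [4 / 5 * p i 0]. *)
have qT i : i \in T -> 8 * k%:R ^+ 3 * x i 0 <= - q i 0.
  move=> iT; have [xi0 xi pi] := Tx i iT; have := xp i iT; rewrite qE.
  by have := v0 i; nra.
have qnT i : i \notin T ->
    - q i 0 <= (4 * k%:R + 1) * x i 0 /\ q i 0 <= (4 * k%:R + 2) * v i 0.
  move=> /nT[xi pi]; rewrite qE; have := v0 i; have := x0 i; have := p0 i.
  by split; nra.
have k3 : 0 < k%:R ^+ 3 :> R by rewrite exprn_gt0//; lra.
pose d i := if i \in T then (x i 0)^-1 else 0.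
pose r i := if i \in T then 0 else k%:R / (if q i 0 < 0 then x i 0 else v i 0).
have dE (z : 'cV[R]_n) : \sum_i d i * z i 0 = \sum_(i in T) z i 0 / x i 0.
  rewrite [RHS]big_mkcond; apply: eq_bigr => i _ /=.
  by rewrite /d; case: ifP => _; rewrite ?mul0r// mulrC.
have r0 i : 0 <= r i.
  by rewrite /r; case: ifP => // _; rewrite divr_ge0//; case: ifP.
have [|||//||y [Pxy st cy [j yj yjx] ry]] := @conformal_step R m n A b x q d r Px.
- by rewrite /q mulmxDr -scalemxAr !mulmxBr Ax Av Ap subrr scaler0 addr0.
- move=> i qi; have [iT|iT] := boolP (i \in T); first by have [] := Tx i iT.
  by have [] := qnT i iT; have := x0 i; nra.
- by move=> i; rewrite /d; case: ifP => // iT; rewrite invr_ge0.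
- rewrite dE -sumrN.
  (* A single far coordinate earns at least [8 * k ^ 3]; the penalty has at most [k] terms of size
     [k * (4 * k + 2)], which is less in total. *)
  apply: (@lt_le_trans _ _ (8 * k%:R ^+ 3)); last first.
    apply: (@le_trans _ _ (- (q i0 0 / x i0 0))).
      by rewrite -mulNr ler_pdivlMr ?qT//; case: (Tx _ i0T).
    apply: (@term_le_sum _ _ (mem T) (fun i => - (q i 0 / x i 0))) => // i iT.
    rewrite -mulNr divr_ge0//; apply: le_trans (qT i iT).
    by rewrite !mulr_ge0// ltW.
  apply: (@le_lt_trans _ _ (k%:R * (k%:R * (4 * k%:R + 2)))); last first.
    by rewrite !exprS expr0 mulr1; nra.
  apply: (@le_trans _ _ (\sum_(i in supp v) k%:R * (4 * k%:R + 2))); last first.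
    rewrite sumr_const -[leLHS]mulr_natl ler_pM2r ?ler_nat//.
    by rewrite mulr_gt0//; lra.
  rewrite [leRHS]big_mkcond; apply: ler_sum => i _; rewrite inE /r.
  case: ifPn => iT; first by rewrite mul0r; case: ifP => // _; rewrite mulr_ge0//; lra.
  have [q1 q2] := qnT i iT; have [x1 p1] := nT i iT.
  (* If [v i 0] vanishes off [T], then so do [x i 0] and [p i 0], hence also [q i 0]. *)
  have [vi|vi] /= := eqVneq (v i 0) 0.
    rewrite qE vi.
    have -> : x i 0 = 0 by apply/eqP; rewrite eq_le x0 andbT; move: x1; rewrite vi mulr0.
    have -> : p i 0 = 0 by apply/eqP; rewrite eq_le p0 andbT; move: p1; rewrite vi mulr0.
    by rewrite !subr0 mulr0 addr0 normr0 mulr0.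
  rewrite -mulrA ler_pM2l; last by lra.
  case: ltP => qi.
    have xi : 0 < x i 0 by have := x0 i; nra.
    rewrite ltr0_norm// mulrC ler_pdivrMr//; nra.
  have vi0 : 0 < v i 0 by rewrite lt_neqAle eq_sym vi v0.
  by rewrite ger0_norm// mulrC ler_pdivrMr.
have [_ xy0] := Pxy.
have ryk : - \sum_i d i * y i 0 <= k%:R.
  rewrite dE -sumrN; apply: (@le_trans _ _ (\sum_(i in T) 1)); last first.
    by rewrite sumr_const ler_nat.
  apply: ler_sum => i iT; have [xi _ _] := Tx i iT.
  by rewrite -mulNr ler_pdivrMr//; have := xy0 i; rewrite mxE; lra.
have ryi i : r i * `|y i 0| < k%:R.
  apply: lt_le_trans ryk; apply: le_lt_trans ry.
  by apply: (@term_le_sum _ _ xpredT (fun i => r i * `|y i 0|)) => // ? _; rewrite mulr_ge0.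
have yq i : (y i 0 < 0 -> q i 0 < 0) /\ (0 < y i 0 -> 0 < q i 0).
  have := cy i => h; split => yi.
    by have := h (negbT (lt_eqF yi)); nra.
  by have := h (negbT (gt_eqF yi)); nra.
exists (x + y); split => //; apply/properP; split; last first.
  have jT : j \in T.
    apply/negPn/negP => jT; have := ryi j.
    rewrite /r (negbTE jT) (yq j).1// yjx normrN ger0_norm// divfK ?ltxx//.
    by rewrite gt_eqF//; lra.
  exists j => //; rewrite inE -leNgt mxE yjx subrr mulr_ge0//.
apply/fintype.subsetP => i; apply: contraLR => iT; have [x1 p1] := nT i iT.
rewrite inE -leNgt mxE kE; have [yi|yi] := leP (y i 0) 0; first by lra.
have qi := (yq i).2 yi.
have vi : 0 < v i 0.
  rewrite lt_neqAle v0 andbT eq_sym; apply: contraTN qi => /eqP vi.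
  by rewrite -leNgt qE vi; have := x0 i; have := p0 i; nra.
(* The penalty bound gives [y i 0 < v i 0], and [0 < q i 0] keeps [x i 0] below
   [(4 * k + 2) / (4 * k + 1)] times [v i 0]; together they stay under the threshold. *)
have := ryi i; rewrite /r (negbTE iT) (lt_gtF qi) -mulrA gtr0_norm//.
rewrite -[ltRHS]mulr1 ltr_pM2l; last by lra.
rewrite mulrC ltr_pdivrMr// mul1r => yv.
by move: qi; rewrite qE; have := x0 i; have := p0 i; nra.
Qed.

(** * Concatenation of circuit walks *)

Lemma circuit_walk0 (R : realType) (m n : nat) (A : 'M[R]_(m, n))
    (P : set 'cV[R]_n) x : P x -> circuit_walk A P 0 x x.
Proof. by move=> Px; exists (fun=> x). Qed.

Lemma circuit_walk_end (R : realType) (m n : nat) (A : 'M[R]_(m, n))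
    (P : set 'cV[R]_n) k x y : circuit_walk A P k x y -> P y.
Proof. by move=> [w [_ <- Pw _]]; exact: Pw. Qed.

Lemma circuit_walk_cat (R : realType) (m n : nat) (A : 'M[R]_(m, n))
    (P : set 'cV[R]_n) k l x y z :
  circuit_walk A P k x y -> circuit_walk A P l y z -> circuit_walk A P (k + l) x z.
Proof.
move=> [w [wx wy Pw sw]] [w' [w'y w'z Pw' sw']].
exists (fun i => if (i <= k)%N then w i else w' (i - k)%N); split => //.
(* For [l = 0] the endpoint falls in the first branch, where [y] and [z] coincide. *)
- have [|] := leqP (k + l) k; last by rewrite addKn.
  by rewrite -{2}[k]addn0 leq_add2l leqn0 => /eqP l0; rewrite -w'z l0 addn0 w'y.
- by move=> i ikl; case: leqP => ik; [exact: Pw | apply: Pw'; rewrite leq_subLR].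
- move=> i ikl; have [ik|ki|ik] := ltngtP i k.
  + exact: sw.
  + by rewrite subSn ?(ltnW ki)//; apply: sw'; rewrite ltn_subLR// ltnW.
  + rewrite ik subSnn wy -w'y; apply: sw'.
    by rewrite -(ltn_add2l k) addn0 -{1}ik.
Qed.

Lemma circuit_walk_rcons (R : realType) (m n : nat) (A : 'M[R]_(m, n))
    (P : set 'cV[R]_n) k x y z :
  circuit_walk A P k x y -> P z -> circuit_step A P y z -> circuit_walk A P k.+1 x z.
Proof.
move=> wxy Pz yz; have Py := circuit_walk_end _ _ _ _ _ _ _ _ wxy.
rewrite -addn1; apply: circuit_walk_cat wxy _.
by exists (fun i => if i is 0%N then y else z); split => // -[].
Qed.

(** * Phases, each losing a far coordinate *)

(** Reduction steps are repeated with the weights given by [p] fixed. Unless the far set shrinks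
    earlier, after [t] of them each ratio [x i 0 / p i 0] on it is at most [1 / (16 * k ^ 3)], and
    one finishing step shrinks it. *)
Lemma phase (R : realType) (m n k t : nat) (A : 'M[R]_(m, n))
    (b : 'cV[R]_m) (v p : 'cV[R]_n) :
  polyhedron A b v -> polyhedron A b p -> (0 < k)%N ->
  (#|supp v| <= k)%N -> (#|far k v p| <= k)%N -> far k v p != finset.set0 ->
  16 * k%:R ^+ 4 * (1 - (4 * k%:R)^-1) ^+ t <= 1 :> R ->
  exists s x, [/\ (s <= t.+1)%N, circuit_walk A (polyhedron A b) s p x &
    far k v x \proper far k v p].
Proof.
move=> Pv Pp k0 cv cT T0 ht; set T := far k v p in cT T0 *.
have [_ v0] := Pv.
have k1 : 1 <= k%:R :> R by rewrite ler1n.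
have pT i : i \in T -> 0 < p i 0.
  by rewrite inE; apply: le_lt_trans; rewrite mulr_ge0.
have rho0 : 0 <= 1 - (4 * k%:R)^-1 :> R.
  by rewrite subr_ge0 invf_le1; lra.
suff /(_ t)[[s [x [st w Tx]]]|[x [w Tx cx]]] : forall s,
    (exists s' x, [/\ (s' <= s)%N, circuit_walk A (polyhedron A b) s' p x &
       far k v x \proper T]) \/
    (exists x, [/\ circuit_walk A (polyhedron A b) s p x, far k v x = T &
       \sum_(i in T) x i 0 / p i 0 <= (1 - (4 * k%:R)^-1) ^+ s * k%:R]).
- by exists s, x; split => //; exact: leqW.
- have Px := circuit_walk_end _ _ _ _ _ _ _ _ w; have [_ x0] := Px.
  have k3 : 0 < 16 * k%:R ^+ 3 :> R by rewrite mulr_gt0// exprn_gt0//; lra.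
  have xp i : i \in T -> 16 * k%:R ^+ 3 * x i 0 <= p i 0.
    move=> iT.
    have : x i 0 / p i 0 <= (1 - (4 * k%:R)^-1) ^+ t * k%:R.
      apply: le_trans cx; apply: (@term_le_sum _ _ (mem T) (fun i => x i 0 / p i 0)) => //.
      by move=> j jT; rewrite divr_ge0// ltW ?pT.
    rewrite ler_pdivrMr ?pT// => xi.
    apply: (@le_trans _ _ (16 * k%:R ^+ 3 * ((1 - (4 * k%:R)^-1) ^+ t * k%:R * p i 0))).
      by rewrite ler_pM2l.
    have -> : 16 * k%:R ^+ 3 * ((1 - (4 * k%:R)^-1) ^+ t * k%:R * p i 0) =
       16 * k%:R ^+ 4 * (1 - (4 * k%:R)^-1) ^+ t * p i 0 :> R.
      by rewrite [k%:R ^+ 4]exprSr; ring.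
    by rewrite -[leRHS]mul1r ler_pM2r ?pT.
  rewrite -Tx in cT T0 xp.
  have [x' [Px' st Tx']] :=
    finishing_step _ _ _ _ _ _ _ _ _ Pv Px Pp k0 cv cT T0 (esym Tx) xp.
  exists t.+1, x'; rewrite Tx in Tx'; split => //.
  exact: circuit_walk_rcons w Px' st.
elim=> [|s [[s' [x [s's w Tx]]]|[x [w Tx cx]]]].
(* At the start every ratio is 1, and there are at most [k] of them. *)
- right; exists p; split => //; first exact: circuit_walk0.
  rewrite expr0 mul1r (eq_bigr (fun=> 1)); first by rewrite sumr_const ler_nat.
  by move=> i iT; rewrite divff// gt_eqF// pT.
- by left; exists s', x; split => //; exact: leqW.
have Px := circuit_walk_end _ _ _ _ _ _ _ _ w.
have [|||x' [Px' st Tx' cx']] := reduction_step _ _ _ _ _ _ v x p Pv Px k0 cv;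
  try by rewrite Tx.
have w' := circuit_walk_rcons _ _ _ _ _ _ _ _ _ w Px' st.
rewrite Tx in Tx' cx'.
have [TE|TN] := eqVneq (far k v x') T; last first.
  by left; exists s.+1, x'; split => //; rewrite finset.properEneq TN.
right; exists x'; split => //; apply: le_trans cx' _.
by rewrite exprS -mulrA ler_wpM2l.
Qed.

Lemma phases (R : realType) (m n k t : nat) (A : 'M[R]_(m, n))
    (b : 'cV[R]_m) (v x : 'cV[R]_n) :
  vertex (polyhedron A b) v -> polyhedron A b x -> (0 < k)%N ->
  (#|supp v| <= k)%N -> (#|far k v x| <= k)%N ->
  16 * k%:R ^+ 4 * (1 - (4 * k%:R)^-1) ^+ t <= 1 :> R ->
  exists2 s, (s <= #|far k v x| * t.+1)%N & circuit_walk A (polyhedron A b) s x v.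
Proof.
move=> vv + k0 cv + ht; have [Pv _] := vv.
have [N] := ubnP #|far k v x|; elim: N x => // N IH x /ltnSE TN Px Tk.
have [T0|T0] := eqVneq (far k v x) finset.set0.
  (* With no far coordinate, [x - v] is a kernel vector supported in [supp v], so [vertex_ker] makes
     it zero. *)
  exists 0%N => //; suff -> : x = v by exact: circuit_walk0.
  apply/eqP; rewrite -subr_eq0; apply/eqP.
  have [Ax x0] := Px; have [Av _] := Pv.
  apply: (vertex_ker _ _ _ _ _ _ _ vv); first by rewrite mulmxBr Ax Av subrr.
  apply/fintype.subsetP => i; rewrite !suppP !mxE; apply: contraNN => /eqP vi.
  have : i \notin far k v x by rewrite T0 finset.in_set0.
  rewrite inE vi mulr0 subr0 -leNgt => xi.
  by rewrite eq_le xi x0.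
have [s [y [st w Ty]]] := phase _ _ _ _ _ _ _ _ _ Pv Px k0 cv Tk T0 ht.
have cy := proper_card Ty.
have [|||s' s't w'] := IH y.
- exact: leq_trans cy TN.
- exact: circuit_walk_end w.
- exact: leq_trans (ltnW cy) Tk.
exists (s + s')%N; last exact: circuit_walk_cat w w'.
apply: leq_trans (leq_add st s't) _.
by rewrite -mulSn leq_mul2r cy orbT.
Qed.

(** * Logarithmic step count and the final bound *)

(** By [1 - z <= expR (- z)], this many steps bring the power down to [m ^ (-8)]; one factor
    [m ^ (-4)] cancels [m ^ 4], and the other cancels 16 because [2 <= m]. *)
Lemma geometric_decay (R : realType) (m t : nat) :
  (2 <= m)%N -> 32 * m%:R * ln m%:R <= t%:R :> R ->
  16 * m%:R ^+ 4 * (1 - (4 * m%:R)^-1) ^+ t <= 1 :> R.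
Proof.
move=> m2 tm.
have m2R : 2 <= m%:R :> R by rewrite ler_nat.
have m0 : 0 < m%:R :> R by lra.
have decay : (1 - (4 * m%:R)^-1) ^+ t <= (m%:R ^+ 8)^-1 :> R.
  apply: (@le_trans _ _ (expR (- (4 * m%:R)^-1) ^+ t)).
    apply: lerXn2r; rewrite ?nnegrE ?expR_ge0//.
      by rewrite subr_ge0 invf_le1; lra.
    by have := expR_ge1Dx (- (4 * m%:R)^-1 : R).
  rewrite -expRM_natl -[m%:R in leRHS]lnK ?posrE// -expRM_natl -expRN ler_expR.
  rewrite mulrN lerN2 ler_pdivlMr; last by lra.
  lra.
apply: (@le_trans _ _ (m%:R ^+ 4 * m%:R ^+ 4 * (m%:R ^+ 8)^-1)); last first.
  by rewrite -exprD divff// expf_neq0// gt_eqF.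
have m40 : 0 < m%:R ^+ 4 :> R by rewrite exprn_gt0.
apply: ler_pM => //.
  by rewrite exprn_ge0// subr_ge0 invf_le1; lra.
rewrite ler_pM2r//.
have -> : 16 = 2 ^+ 4 :> R by rewrite -natrX.
by apply: lerXn2r; rewrite ?nnegrE// ltW.
Qed.

Theorem theorem1p1 (R : realType) :
  exists C : R, 0 < C /\
    forall (m n : nat) (A : 'M[R]_(m, n)) (b : 'cV[R]_m),
      (2 <= m)%N -> \rank A = m ->
      (circuit_diameter A (polyhedron A b)
         <= (C * m%:R ^+ 2 * ln (m%:R : R))%:E)%E /\
      forall u v : 'cV[R]_n,
        vertex (polyhedron A b) u -> vertex (polyhedron A b) v ->
        exists2 k : nat, circuit_walk A (polyhedron A b) k u v &
          k%:R <= C * m%:R ^+ 2 * ln (m%:R : R).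
Proof.
have ln2 : 0 < ln 2 :> R by rewrite ln_gt0// ltr1n.
have C0 : 0 < 32 + (ln 2)^-1 :> R by rewrite addr_gt0// invr_gt0.
(* The 32 comes from [geometric_decay]. The term [(ln 2)^-1] pays for two more steps per phase, one
   from rounding up and one finishing step, since [2 * ln 2 <= m * ln m]. *)
exists (32 + (ln 2)^-1); split => // m n A b m2 _.
have short u v : vertex (polyhedron A b) u -> vertex (polyhedron A b) v ->
    exists2 k : nat, circuit_walk A (polyhedron A b) k u v &
      k%:R <= (32 + (ln 2)^-1) * m%:R ^+ 2 * ln (m%:R : R).
  move=> vu vv; have [Pu _] := vu; have [[_ v0] _] := vv.
  have m2R : 2 <= m%:R :> R by rewrite ler_nat.
  have lnm : ln 2 <= ln m%:R :> R by rewrite ler_ln ?posrE//; lra.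
  have tm0 : 0 <= 32 * m%:R * ln m%:R :> R by rewrite !mulr_ge0//; lra.
  have /andP[lt_t gt_t] := truncn_itv tm0.
  set t := Num.truncn _ in lt_t gt_t.
  have cu : (#|far m v u| <= m)%N.
    apply: leq_trans (card_supp_vertex _ _ _ _ _ _ vu); apply: subset_leq_card.
    apply/fintype.subsetP => i; rewrite suppP inE => ui.
    by rewrite gt_eqF//; apply: le_lt_trans ui; rewrite mulr_ge0.
  have m0 : (0 < m)%N by exact: ltn_trans m2.
  have [s st w] := phases _ _ _ _ t.+1 _ _ _ _ vv Pu m0
    (card_supp_vertex _ _ _ _ _ _ vv) cu (geometric_decay _ _ _ m2 (ltW gt_t)).
  exists s => //; apply: (@le_trans _ _ (m * t.+2)%:R).
    by rewrite ler_nat (leq_trans st)// leq_mul2r cu orbT.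
  have lnm1 : 1 <= (ln 2)^-1 * ln m%:R :> R by rewrite mulrC ler_pdivlMr// mul1r.
  rewrite natrM -addn2 natrD.
  apply: (@le_trans _ _ (m%:R * (32 * m%:R * ln m%:R + 2))).
    by rewrite ler_pM2l ?lerD2r//; lra.
  have -> : (32 + (ln 2)^-1) * m%:R ^+ 2 * ln m%:R =
     m%:R * (32 * m%:R * ln m%:R + m%:R * ((ln 2)^-1 * ln m%:R)) :> R by ring.
  rewrite ler_pM2l; last by lra.
  rewrite lerD2l; nra.
split; last exact: short.
apply: ge_ereal_sup => _ [[u v] /= [vu vv] <-].
have [k w kC] := short u v vu vv.
apply: (@le_trans _ _ (k%:R)%:E); last by rewrite lee_fin.
by apply: ereal_inf_lbound; exists k.
Qed.
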